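(* If $r$ divides the inseparable degree $[K:F]_{\rm i}$, then $\mathscr{D}(K,r,\pi)$ is nonempty for every monic irreducible $\pi\in A$.
   Context: Let $p$ be a prime, $q$ a power of $p$, $A=\mathbb{F}_q[t]$, $F=\mathbb{F}_q(t)$. $K$ is a finite extension of $F$, $K_{\rm s}$ the separable closure of $F$ in $K$, $[K:F]_{\rm i}=[K:K_{\rm s}]$, and $r$ a positive integer. For a monic irreducible $\pi\in A$ let $\mathbb{F}_\pi=A/\pi A$, $q_\pi=\#\mathbb{F}_\pi$. $K\{\tau\}$ is the twisted polynomial ring with $\tau c=c^q\tau$. A Drinfeld module of rank $r$ over $K$ is an $\mathbb{F}_q$-algebra homomorphism $\phi:A\to K\{\tau\}$ with $\phi_t=t+c_1\tau+\cdots+c_r\tau^r$, $c_r\ne0$; isomorphisms over $L\supseteq K$ are $\psi_a=c\phi_ac^{-1}$, $c\in L^\times$. $\phi[\pi]=\{\lambda\in K^{\rm sep}:\phi_\pi(\lambda)=0\}$ is an $r$-dimensional $\mathbb{F}_\pi$-vector space with $G_K$-action, giving $\bar\rho_{\phi,\pi}:G_K\to\mathrm{GL}_r(\mathbb{F}_\pi)$. $\phi$ has good reduction at a finite place $v$ if it is isomorphic over $K_v$ to some $\psi$ with $\psi_t=t+\sum c_i'\tau^i$, $c_i'\in\mathcal{O}_{K_v}$, $c_r'\in\mathcal{O}_{K_v}^\times$. The Carlitz module is $\mathcal{C}_t=t+\tau$ and $\chi_\pi:G_F\to\mathrm{Aut}(\mathcal{C}[\pi])=\mathbb{F}_\pi^\times$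 is the mod $\pi$ Carlitz character. $\mathscr{D}(K,r,\pi)$ is the set of $K$-isomorphism classes of rank-$r$ Drinfeld modules $\phi$ over $K$ such that (D1) $\phi$ has good reduction at every finite place of $K$ not above $\pi$, and (D2) $\bar\rho_{\phi,\pi}$ is isomorphic to an upper triangular representation with diagonal characters $\chi_\pi^{i_1},\dots,\chi_\pi^{i_r}$, $0\le i_s\le q_\pi-1$. *)

(* Defs.v *)
From HB Require Import structures.
From mathcomp Require Import all_boot all_order all_algebra all_field fraction.
Set Implicit Arguments. Unset Strict Implicit. Unset Printing Implicit Defensive.
Import Order.TTheory GRing.Theory.
Local Open Scope ring_scope.

Section Defs.
Variable k : finFieldType.
Local Notation A := {poly k}.
Local Notation F := {fraction {poly k}}.

Definition qk : nat := #|k|.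

(* q_pi = #|A / pi A| = q ^ deg pi *)
Definition q_pi (pi : A) : nat := (qk ^ (size pi).-1)%N.

Definition embA (K : fieldExtType F) (a : A) : K := (@FracField.tofrac _ a)%:A.

Definition is_separable_closure (K : fieldExtType F) (Ks : {subfield K}) : Prop :=
  forall x : K, (x \in Ks) = separable_element 1%VS x.

(* Action of phi_t = tt + c_1 tau + ... + c_r tau^r on an element x of a ring
   R (tau x = x^q); cs = [:: c_1; ...; c_r]. *)
Definition drin_t (R : pzRingType) (tt : R) (cs : seq R) (x : R) : R :=
  tt * x + \sum_(i < size cs) cs`_i * x ^+ (qk ^ i.+1).

(* phi_a for a = sum_i a_i t^i in A acts as sum_i a_i phi_t^i
   (constants of F_q commute with tau since c^q = c).
   emb : A -> R is the structure map. *)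
Definition drin_act (R : pzRingType) (emb : A -> R) (cs : seq R) (a : A) (x : R) : R :=
  \sum_(i < size a) emb (a`_i)%:P * iter i (drin_t (emb 'X) cs) x.

Definition carlitz_act (R : pzRingType) (emb : A -> R) (a : A) (x : R) : R :=
  drin_act emb [:: 1] a x.

(* A Drinfeld module of rank r over K, given by the coefficients
   cs = [:: c_1; ...; c_r] of phi_t = t + c_1 tau + ... + c_r tau^r, c_r <> 0. *)
Definition drinfeld_module (K : fieldExtType F) (r : nat) (cs : seq K) : Prop :=
  (0 < r)%N /\ size cs = r /\ last 1 cs != 0.

(* A finite place of K, given by its valuation ring O: a proper valuation ring
   of K containing (the image of) A. *)
Definition finite_place (K : fieldExtType F) (O : {pred K}) : Prop :=
  [/\ 1 \in O,
      (forall x y, x \in O -> y \in O -> (x - y \in O) /\ (x * y \in O)),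
      (forall x, x != 0 -> (x \in O) \/ (x^-1 \in O)),
      (exists x, x \notin O) &
      (forall a : A, embA K a \in O)].

(* The place O lies above pi iff pi is in the maximal ideal of O. *)
Definition place_above (K : fieldExtType F) (O : {pred K}) (pi : A) : Prop :=
  (embA K pi)^-1 \notin O.

Definition unit_of (K : fieldExtType F) (O : {pred K}) (x : K) : Prop :=
  [/\ x != 0, x \in O & x^-1 \in O].

(* Good reduction at O: phi is isomorphic (psi_t = c phi_t c^-1, whose
   coefficients are c * c_i * c^(-q^i)) to a Drinfeld module with integral
   coefficients and unit leading coefficient. *)
Definition good_reduction (K : fieldExtType F) (O : {pred K}) (cs : seq K) : Prop :=
  exists c : K, c != 0 /\
    (forall i : 'I_(size cs), c * cs`_i * c ^- (qk ^ i.+1) \in O) /\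
    unit_of O (c * last 1 cs * c ^- (qk ^ size cs)).

Definition D1 (K : fieldExtType F) (pi : A) (cs : seq K) : Prop :=
  forall O : {pred K}, finite_place O -> ~ place_above O pi -> good_reduction O cs.

(* (D2) the mod pi representation on phi[pi] is isomorphic to an upper
   triangular one with diagonal chi_pi^(i_1), ..., chi_pi^(i_r).
   The absolute Galois group G_K is realized as the group of automorphisms
   of an algebraically closed field Omega over K fixing K pointwise; we
   require this for every such Omega. *)
Definition D2 (K : fieldExtType F) (r : nat) (pi : A) (cs : seq K) : Prop :=
  forall (Omega : closedFieldType) (iota : {rmorphism K -> Omega}),
  let emb := fun a : A => iota (embA K a) in
  let phi := drin_act emb (map iota cs) in
  let C := carlitz_act emb in
  exists (lam : 'I_r -> Omega) (e : 'I_r -> nat),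
    (forall j, phi pi (lam j) = 0) /\
    (forall mu, phi pi mu = 0 ->
       exists a : 'I_r -> A, mu = \sum_j phi (a j) (lam j)) /\
    (forall a : 'I_r -> A, \sum_j phi (a j) (lam j) = 0 -> forall j, (pi %| a j)%R) /\
    (forall j, (e j <= (q_pi pi).-1)%N) /\
    (* for every sigma in G_K: upper triangular with diagonal chi_pi(sigma)^(e j) *)
    (forall sigma : {rmorphism Omega -> Omega}, bijective sigma ->
       (forall x : K, sigma (iota x) = iota x) ->
       exists c : A,
         (forall mu, C pi mu = 0 -> sigma mu = C c mu) /\
         (forall j : 'I_r, exists b : 'I_r -> A,
            sigma (lam j) = phi (c ^+ e j) (lam j)
                            + \sum_(l < r | (l < j)%N) phi (b l) (lam l))).

Definition in_D (K : fieldExtType F) (r : nat) (pi : A) (cs : seq K) : Prop :=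
  [/\ drinfeld_module r cs, D1 pi cs & D2 r pi cs].

End Defs.

(* Main.v *)
(* Write r = p^m. Since K is purely inseparable over Ks and [F : F^p] = p, every
   purely inseparable step of K / Ks adjoins a p-th root of the current root of t,
   so K contains s with s^r = t. Restrict the Carlitz module of F_q[s] to F_q[t]:
   phi_t = (s + tau)^r. It is monic with integral coefficients, whence good
   reduction everywhere. If h is the irreducible polynomial with
   pi(X^r) = h(X)^r, then phi[pi] is the h^r-torsion of the Carlitz module over
   F_q[s]; its filtration by h^i-torsion is Galois stable with every graded piece
   isomorphic to the h-torsion, which x |-> x^r identifies with C[pi]. If sigma
   acts on C[pi] as c, it acts on each piece as the r-th root of c in F_pi, that
   is as c^(p^j) where p^(m + j) is a power of q_pi. *)
Require Import Defs.
From HB Require Import structures.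
From mathcomp Require Import all_boot all_order all_algebra all_field fraction.
From mathcomp Require Import generic_quotient.
Set Implicit Arguments. Unset Strict Implicit. Unset Printing Implicit Defensive.
Import Order.TTheory GRing.Theory.
Local Open Scope ring_scope.
Local Open Scope quotient_scope.

(** * Purely inseparable steps of degree p and the ring E^p[u] *)

Section FrobeniusSpan.

Variables (F0 : fieldType) (L : fieldExtType F0) (p : nat).
Hypothesis pcharL : p \in [pchar L].
Implicit Types (E : {subfield L}) (u x z : L).

(* [frob_span E u z]: z lies in E^p[u]. *)
Definition frob_span E u z :=
  exists2 f, f \is a polyOver E & z = (map_poly (pFrobenius_aut pcharL) f).[u].

Lemma frob_span_exp E u x : x \in E -> frob_span E u (x ^+ p).
Proof.
by move=> Ex; exists x%:P; rewrite ?polyOverC // map_polyC hornerC /= pFrobenius_autE.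
Qed.

Lemma frob_span1 E u : frob_span E u 1.
Proof. by rewrite -(expr1n _ p); apply/frob_span_exp/rpred1. Qed.

Lemma frob_span0 E u : frob_span E u 0.
Proof.
have <-: 0 ^+ p = 0 :> L by rewrite expr0n (gtn_eqF (prime_gt0 (pcharf_prime pcharL))).
exact/frob_span_exp/rpred0.
Qed.

Lemma frob_span_gen E u : frob_span E u u.
Proof. by exists 'X; rewrite ?polyOverX // map_polyX hornerX. Qed.

Lemma frob_spanD E u x z :
  frob_span E u x -> frob_span E u z -> frob_span E u (x + z).
Proof.
by case=> f Ef -> [g Eg ->]; exists (f + g); rewrite ?rpredD // rmorphD hornerD.
Qed.

Lemma frob_spanM E u x z :
  frob_span E u x -> frob_span E u z -> frob_span E u (x * z).
Proof.
by case=> f Ef -> [g Eg ->]; exists (f * g); rewrite ?rpredM // rmorphM hornerM.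
Qed.

Lemma frob_spanX E u x n : frob_span E u x -> frob_span E u (x ^+ n).
Proof.
move=> Sx; elim: n => [|n IHn]; first exact: frob_span1.
by rewrite exprS; apply: frob_spanM.
Qed.

(** The inverse is x^(p-1) times the p-th power of x^-1, which is in E^p. *)
Lemma frob_spanV E u x : x \in E -> frob_span E u x -> frob_span E u x^-1.
Proof.
move=> Ex Sx; have [-> | nz_x] := eqVneq x 0.
  by rewrite invr0; apply: frob_span0.
have ->: x^-1 = x ^+ p.-1 * x^-1 ^+ p.
  rewrite -{2}(prednK (prime_gt0 (pcharf_prime pcharL))) exprSr mulrA -exprMn.
  by rewrite divff // expr1n mul1r.
by apply: frob_spanM; [apply: frob_spanX | apply/frob_span_exp/rpredVr].
Qed.

Lemma frob_span_horner E u z (f : {poly L}) :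
  (forall i, frob_span E u f`_i) -> frob_span E u z -> frob_span E u f.[z].
Proof.
move=> Sf Sz; rewrite horner_coef; apply: big_ind => [|x y|i _].
- exact: frob_span0.
- exact: frob_spanD.
by apply: frob_spanM; last exact: frob_spanX.
Qed.

(** Reduce exponents mod p: if i = p a + l, the factor u^(p a) is the p-th power of u^a in E and
    joins the coefficient. *)
Lemma frob_span_lt E u z : u \in E -> frob_span E u z ->
  exists a : 'I_p -> subvs_of E, z = \sum_(l < p) vsval (a l) ^+ p * u ^+ l.
Proof.
move=> Eu [f /polyOverP Ef ->]; have p_gt0 := prime_gt0 (pcharf_prime pcharL).
rewrite horner_coef; elim/big_ind: _ => [|x y [a ->] [b ->]|i _].
- exists (fun=> 0); rewrite big1 // => l _.
  by rewrite raddf0 expr0n (gtn_eqF p_gt0) mul0r.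
- exists (fun l => a l + b l); rewrite -big_split; apply: eq_bigr => l _ /=.
  by rewrite exprDn_pchar ?pnatE ?(pcharf_prime pcharL) // mulrDl.
pose l0 := Ordinal (ltn_pmod i p_gt0).
exists (fun l => if l == l0 then vsproj E (f`_i * u ^+ (i %/ p)) else 0).
rewrite (bigD1 l0) //= eqxx big1 ?addr0 => [|l /negPf->]; last first.
  by rewrite raddf0 expr0n (gtn_eqF p_gt0) mul0r.
rewrite vsprojK ?rpredM ?rpredX ?Ef // coef_map /= pFrobenius_autE exprMn -mulrA.
by rewrite -exprM -exprD -divn_eq.
Qed.

(** A separable x would lie in E, being purely inseparable over it. So the minimal polynomial has
    zero derivative and p divides its degree; it also divides X^p - x^p. *)
Lemma adjoin_degree_insep E x :
  x \notin E -> x ^+ p \in E -> adjoin_degree E x = p.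
Proof.
move=> E'x Exp; have p_pr := pcharf_prime pcharL.
have: ~~ separable_element E x.
  apply: contra E'x => sep_x; rewrite -separable_inseparable_element sep_x.
  by apply/purely_inseparable_elementP_pchar; exists p; rewrite // pnatE.
rewrite separable_nz_der negbK => /eqP df0.
pose n := adjoin_degree E x; have sz_f : size (minPoly E x) = n.+1 := size_minPoly E x.
have fn1: (minPoly E x)`_n = 1.
  by rewrite -(monicP (monic_minPoly E x)) lead_coefE sz_f.
have: (p %| n)%N.
  by rewrite (dvdn_pcharf pcharL) -fn1 -[n in _ *+ n]prednK // -coef_deriv df0 coef0.
move/dvdn_leq=> /(_ (ltn0Sn _)) le_pn; apply/eqP; rewrite eqn_leq le_pn andbT.
have g_p : ('X^p - (x ^+ p)%:P : {poly L}) \is a polyOver E.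
  by rewrite rpredB ?rpredX ?polyOverX ?polyOverC.
have rt : root ('X^p - (x ^+ p)%:P) x by rewrite rootE !hornerE subrr.
have szg := size_XnsubC (x ^+ p) (prime_gt0 p_pr).
have := dvdp_leq _ (minPoly_dvdp g_p rt).
by rewrite -size_poly_gt0 szg sz_f ltnS; apply.
Qed.

(* Here E = E^p(u), and y = x^p lies in E but not in E^p, so y also generates E
   over E^p; expressing u in the basis of powers of y gives its p-th root. *)
Lemma frob_span_root E u x : u \in E ->
  (forall z, z \in E -> frob_span E u z) -> x \notin E -> x ^+ p \in E ->
  exists2 w, w ^+ p = u & w \notin E.
Proof.
move=> Eu genE E'x Exp; have p_pr := pcharf_prime pcharL.
have p_gt0 := prime_gt0 p_pr.
have : exists M : 'M[subvs_of E]_p, forall j : 'I_p,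
    (x ^+ j) ^+ p = \sum_l vsval (M j l) ^+ p * u ^+ l.
  have genj (j : 'I_p) : exists a : {ffun 'I_p -> subvs_of E},
      (x ^+ j) ^+ p == \sum_l vsval (a l) ^+ p * u ^+ l.
    have [|a Da] := frob_span_lt Eu (genE ((x ^+ j) ^+ p) _).
      by rewrite exprAC rpredX.
    by exists (finfun a); rewrite Da; apply/eqP/eq_bigr => l _; rewrite ffunE.
  exists (\matrix_(j, l) xchoose (genj j) l) => j.
  by rewrite (eqP (xchooseP (genj j))); apply: eq_bigr => l _; rewrite mxE.
case=> M DM.
(* Frobenius is additive, so on coefficient rows over the x^j taking p-th powers becomes v |-> v
   M. *)
have combE (v : 'rV[subvs_of E]_p) :
  (\sum_j vsval (v 0 j) * x ^+ j) ^+ p = \sum_l vsval ((v *m M) 0 l) ^+ p * u ^+ l.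
  rewrite -(pFrobenius_autE pcharL) rmorph_sum /=.
  under eq_bigr => j _ do rewrite pFrobenius_autE exprMn DM mulr_sumr.
  rewrite exchange_big; apply: eq_bigr => l _ /=.
  rewrite mxE -(pFrobenius_autE pcharL) !rmorph_sum mulr_suml /=.
  by apply: eq_bigr => j _; rewrite pFrobenius_autE exprMn mulrA.
(* A kernel row would give a nonzero polynomial over E of degree below p vanishing at x. *)
have Mu : M \in unitmx.
  rewrite -row_free_unit -kermx_eq0; apply: contraT => /rowV0Pn[v /sub_kermxP vM0 nz_v].
  pose f : {poly L} := \poly_(j < p) (if insub j is Some i then vsval (v 0 i) else 0).
  have fE (j : 'I_p) : f`_j = vsval (v 0 j) by rewrite coef_poly ltn_ord valK.
  have Ef : f \is a polyOver E.
    by apply: polyOver_poly => j _; case: insub => [i|]; rewrite ?subvsP ?rpred0.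
  have rt : root f x.
    have /eqP: (\sum_j vsval (v 0 j) * x ^+ j) ^+ p = 0.
      by rewrite combE big1 // => l _; rewrite vM0 mxE raddf0 expr0n gtn_eqF // mul0r.
    rewrite expf_eq0 p_gt0 /= => /eqP vx0.
    rewrite rootE horner_poly; apply/eqP; rewrite -[RHS]vx0; apply: eq_bigr => j _.
    by rewrite valK.
  have f0 : f = 0.
    apply: contraTeq (size_poly p _ : size f <= p)%N => nz_f; rewrite -ltnNge.
    have := dvdp_leq nz_f (minPoly_dvdp Ef rt).
    by rewrite size_minPoly (adjoin_degree_insep E'x Exp).
  case/eqP: nz_v; apply/rowP => j; rewrite mxE; apply: val_inj => /=.
  by rewrite -fE f0 coef0.
(* The unit row at index 1 encodes u^1; its preimage under [M] gives the coefficients of a p-th root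
   of u. *)
pose i1 := Ordinal (prime_gt1 p_pr).
pose b : 'rV_p := delta_mx 0 i1 *m invmx M.
have w_u : (\sum_j vsval (b 0 j) * x ^+ j) ^+ p = u.
  rewrite combE mulmxKV // (bigD1 i1) //= big1 ?addr0.
    by rewrite mxE !eqxx /= algid1 expr1n mul1r.
  move=> l /negPf nl; rewrite mxE nl andbF raddf0 expr0n gtn_eqF // mul0r //.
exists (\sum_j vsval (b 0 j) * x ^+ j) => //.
(* If w were in E, then x^p = sum a_l^p w^(p l) would be the p-th power of an element of E, and
   Frobenius is injective. *)
set w := \sum_j _ in w_u *; apply: contra E'x => Ew.
have [a Da] := frob_span_lt Eu (genE _ Exp).
suffices ->: x = \sum_l vsval (a l) * w ^+ l.
  by apply: rpred_sum => l _; rewrite rpredM ?subvsP ?rpredX.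
apply: (fmorph_inj (pFrobenius_aut pcharL)); rewrite rmorph_sum /=.
rewrite pFrobenius_autE Da; apply: eq_bigr => l _.
by rewrite pFrobenius_autE exprMn exprAC w_u.
Qed.
End FrobeniusSpan.

(** * An r-th root of t in K *)

Lemma fraction_div (R : idomainType) (x : {fraction R}) :
  exists2 ab : R * R, ab.2 != 0 & x = FracField.tofrac ab.1 / FracField.tofrac ab.2.
Proof.
elim/quotW: x => r; exists (frac r); first exact: denom_ratioP.
have nz_d : FracField.tofrac (frac r).2 != 0 by rewrite tofrac_eq0 denom_ratioP.
apply: (canRL (mulfK nz_d)).
unlock FracField.tofrac. rewrite -[LHS]FracField.pi_mul.
apply/eqmodP; rewrite /= FracField.equivfE /FracField.mulf.
by rewrite !numden_Ratio ?mulf_neq0 ?denom_ratioP ?oner_eq0 // !mulr1 mulrC.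
Qed.

HB.instance Definition _ (k : finFieldType) (K : fieldExtType {fraction {poly k}}) :=
  GRing.RMorphism.copy (@embA k K) (in_alg K \o @FracField.tofrac {poly k}).

Section PurelyInseparable.

Variables (k : finFieldType) (K : fieldExtType {fraction {poly k}}) (p : nat).
Hypothesis pchark : p \in [pchar k].

Lemma pchar_ext : p \in [pchar K].
Proof. exact: (rmorph_pchar (embA K \o polyC) pchark). Qed.

Lemma embA_horner a : embA K a = (map_poly (embA K \o polyC) a).[embA K 'X].
Proof.
rewrite -{1}[a]coefK poly_def rmorph_sum horner_coef size_map_poly.
by apply: eq_bigr => i _; rewrite -mul_polyC rmorphM rmorphXn coef_map.
Qed.

Lemma finField_pth_root (c : k) : exists d, c = d ^+ p.
Proof.
have inj := fmorph_inj (pFrobenius_aut pchark).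
by exists (invF inj c); rewrite -pFrobenius_autE f_invF.
Qed.

Variables (Ks : {subfield K}) (u : K) (n : nat).
Hypotheses (Ks_sep : is_separable_closure Ks) (u_t : u ^+ (p ^ n) = embA K 'X).

(** As t = u^(p^n) and constants are p-th powers, E^p[u] contains A, and F by inverses. A separable
    x lies in F(x^p), which gives Ks. *)
Lemma frob_span_full z : z \in <<Ks; u>>%VS -> frob_span pchar_ext <<Ks; u>>%AS u z.
Proof.
set E := <<Ks; u>>%AS.
have SA a : frob_span pchar_ext E u (embA K a).
  rewrite embA_horner; apply: frob_span_horner => [i|].
    rewrite coef_map /=; have [d ->] := finField_pth_root a`_i.
    by rewrite polyC_exp rmorphXn; apply/frob_span_exp/rpredZ/rpred1.
  by rewrite -u_t; apply/frob_spanX/frob_span_gen.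
have SF c : frob_span pchar_ext E u c%:A.
  have [[a b] /= nz_b ->] := fraction_div c.
  rewrite -[_%:A]/(in_alg K _) fmorph_div; apply: frob_spanM; first exact: SA.
  by apply: frob_spanV; [apply/rpredZ/rpred1 | apply: SA].
have SKs x : x \in Ks -> frob_span pchar_ext E u x.
  move=> Ksx; have := Ksx; rewrite Ks_sep (pcharf_p_separable _ _ 0 pchar_ext).
  case/Fadjoin_polyP => f /polyOverP f1 ->; apply: frob_span_horner => [i|].
    by have /vlineP[c ->] := f1 i; apply: SF.
  by apply/frob_span_exp/(subvP (subv_adjoin Ks u)).
case/Fadjoin_polyP => f /polyOverP fKs ->.
by apply: frob_span_horner => [i|]; [apply/SKs/fKs | apply: frob_span_gen].
Qed.

(** Take z outside E. Some z^(p^N) lies in Ks; just before the first such power that enters E stands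
    an x as [frob_span_root] requires. *)
Lemma insep_step : <<Ks; u>>%VS != fullv ->
  exists2 w, w ^+ p = u & w \notin <<Ks; u>>%VS.
Proof.
move=> ltEK; set E := <<Ks; u>>%AS.
have [z _ E'z] : exists2 z, z \in fullv & z \notin E.
  by apply/subvPn; apply: contra ltEK => sKE; rewrite eqEsubv subvf.
have exN : exists N, z ^+ (p ^ N) \in E.
  have [m /andP[pnat_m]] := separable_exponent_pchar 1%AS z.
  rewrite -Ks_sep => Ksz; have /p_natP[N Dm]: p.-nat m.
    by rewrite -(eq_pnat _ (pcharf_eq pchar_ext)).
  by exists N; rewrite -Dm; apply: (subvP (subv_adjoin Ks u)).
case: (ex_minnP exN) => -[|N]; first by rewrite expr1 (negPf E'z).
rewrite expnSr exprM => Ex minN.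
have E'x : z ^+ (p ^ N) \notin E by apply/negP => /minN; rewrite ltnn.

have genE y : y \in E -> frob_span pchar_ext E u y by apply: frob_span_full.
exact: frob_span_root (memv_adjoin Ks u) genE E'x Ex.
Qed.

End PurelyInseparable.

(** Climb from Ks(t) = Ks: each step replaces u by a p-th root outside Ks(u) and multiplies the
    degree by p, until K is reached. *)
Lemma insep_generator (k : finFieldType) (K : fieldExtType {fraction {poly k}})
    (p : nat) (Ks : {subfield K}) :
    p \in [pchar k] -> is_separable_closure Ks ->
  exists n (u : K), u ^+ (p ^ n) = embA K 'X /\ (\dim_Ks {:K} %| p ^ n)%N.
Proof.
move=> pchark Ks_sep; have pcharK := pchar_ext K pchark.
(* [d] bounds the missing dimension, hence the number of steps left. *)
suffices IH d n (u : K) : u ^+ (p ^ n) = embA K 'X ->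
    (\dim_Ks <<Ks; u>> %| p ^ n)%N -> (\dim {:K} <= \dim <<Ks; u>> + d)%N ->
    exists n (u : K), u ^+ (p ^ n) = embA K 'X /\ (\dim_Ks {:K} %| p ^ n)%N.
  apply: (IH (\dim {:K}) 0%N (embA K 'X)); rewrite ?expr1 ?leq_addl //.
  have /Fadjoin_idP-> : embA K 'X \in Ks; last by rewrite divnn adim_gt0.
  apply: (subvP (sub1v Ks)); exact/rpredZ/rpred1.
elim: d => [|d IHd] in n u * => u_t dvd_p le_d;
    (have [Ku | ltEK] := eqVneq <<Ks; u>>%VS fullv; first by exists n, u; rewrite -Ku).
  case/eqP: ltEK; apply/eqP; rewrite eqEdim subvf /=.
  by rewrite addn0 in le_d.
have [w w_u E'w] := insep_step pchark Ks_sep u_t ltEK.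
have sEw : (<<Ks; u>> <= <<Ks; w>>)%VS.
  by apply/FadjoinP; rewrite subv_adjoin -w_u rpredX ?memv_adjoin.
have DEw : <<<<Ks; u>>; w>>%VS = <<Ks; w>>%VS.
  apply/eqP; rewrite eqEsubv; apply/andP; split.
    by apply/(@FadjoinP _ _ <<Ks; u>>%AS); rewrite sEw memv_adjoin.
  apply/FadjoinP; rewrite memv_adjoin; split=> //.
  exact: subv_trans (subv_adjoin _ u) (subv_adjoin _ w).
have dimE : (\dim <<Ks; w>> = p * \dim <<Ks; u>>)%N.
  rewrite -DEw (dim_Fadjoin <<Ks; u>>%AS) (adjoin_degree_insep pcharK E'w) //.
  by rewrite w_u memv_adjoin.
have p_gt1 := prime_gt1 (pcharf_prime pcharK).
apply: (IHd n.+1 w).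
- by rewrite expnS exprM w_u.
- rewrite dimE expnS -muln_divA ?dvdn_mul //.
  exact: (@field_dimS _ _ Ks <<Ks; u>>%AS (subv_adjoin Ks u)).
apply: leq_trans le_d _; rewrite dimE addnS -addSn leq_add2r.
by rewrite ltn_Pmull ?adim_gt0.
Qed.

Lemma t_root_insep_degree (k : finFieldType) (K : fieldExtType {fraction {poly k}})
    (p : nat) (Ks : {subfield K}) (r : nat) :
    p \in [pchar k] -> is_separable_closure Ks -> (r %| \dim_Ks {:K})%N ->
  exists m (s : K), r = (p ^ m)%N /\ s ^+ r = embA K 'X.
Proof.
move=> pchark Ks_sep dvd_r; have p_pr := pcharf_prime pchark.
have [n [u [u_t dvd_n]]] := insep_generator pchark Ks_sep.
have /(dvdn_pfactor _ _ p_pr)[m le_mn Dr] := dvdn_trans dvd_r dvd_n.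
exists m, (u ^+ (p ^ (n - m))); rewrite Dr; split=> //.
by rewrite -exprM -expnD subnK.
Qed.

(** * Iterated Frobenius as a ring morphism *)

Section IterFrobenius.

Variables (R : comNzRingType) (p : nat).

Definition iter_frob of p \in [pchar R] := fun (n : nat) (x : R) => x ^+ (p ^ n).

Variables (pcharR : p \in [pchar R]) (n : nat).

Lemma iter_frob_is_nmod_morphism : nmod_morphism (iter_frob pcharR n).
Proof.
have pnat_pn : [pchar R].-nat (p ^ n)%N.
  by rewrite pnatX pnatE ?pcharR ?(pcharf_prime pcharR).
split=> [|x y]; last by rewrite /iter_frob exprDn_pchar.
by rewrite /iter_frob expr0n expn_eq0 (gtn_eqF (prime_gt0 (pcharf_prime pcharR))).
Qed.

Lemma iter_frob_is_monoid_morphism : monoid_morphism (iter_frob pcharR n).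
Proof. by split=> [|x y]; rewrite /iter_frob (expr1n, exprMn). Qed.

HB.instance Definition _ :=
  GRing.isNmodMorphism.Build R R (iter_frob pcharR n) iter_frob_is_nmod_morphism.
HB.instance Definition _ :=
  GRing.isMonoidMorphism.Build R R (iter_frob pcharR n) iter_frob_is_monoid_morphism.

End IterFrobenius.

Arguments iter_frob : simpl never.

(** Frobenius of k[X] acts on coefficients and on X separately. This trades substitution of X^r for
    an r-th power. *)
Lemma map_iter_frob (k : comNzRingType) p (pchark : p \in [pchar k]) n (P : {poly k}) :
  map_poly (iter_frob pchark n) P \Po 'X^(p ^ n) = P ^+ (p ^ n).
Proof.
elim/poly_ind: P => [|P c IHP].
  by rewrite raddf0 comp_poly0 expr0n expn_eq0 (gtn_eqF (prime_gt0 (pcharf_prime pchark))).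
have pcharP : p \in [pchar {poly k}] := rmorph_pchar polyC pchark.
rewrite -[RHS]/(iter_frob pcharP n _) !rmorphD !rmorphM /= map_polyX map_polyC /=.
rewrite comp_polyX comp_polyC IHP.
by rewrite /iter_frob polyC_exp.
Qed.

(** * Polynomials acting through an additive operator *)

Section PolyAction.

Variables (k : nzRingType) (V : comNzRingType) (ak : {rmorphism k -> V}) (D : V -> V).
Implicit Types (P Q : {poly k}) (x y : V).

(** P(D) applied to x, in the shape of [drin_act] so that the two are convertible. *)
Definition act P x := \sum_(i < size P) ak P`_i * iter i D x.

Lemma actE P x : act P x = \sum_(i < size P) ak P`_i * iter i D x.
Proof. by []. Qed.

Lemma act_widen n P x : (size P <= n)%N -> act P x = \sum_(i < n) ak P`_i * iter i D x.
Proof.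
move=> le_n; rewrite /act (big_ord_widen n (fun i => ak P`_i * iter i D x) le_n).
rewrite big_mkcond; apply: eq_bigr => i _.
by case: ltnP => // le_i; rewrite nth_default // rmorph0 mul0r.
Qed.

Lemma actC c x : act c%:P x = ak c * x.
Proof. by rewrite (act_widen _ (size_polyC_leq1 c)) big_ord1 coefC. Qed.

Lemma act0 x : act 0 x = 0.
Proof. by rewrite -polyC0 actC rmorph0 mul0r. Qed.

Lemma actD P Q x : act (P + Q) x = act P x + act Q x.
Proof.
set n := maxn (size P) (size Q).
rewrite (@act_widen n P) ?leq_maxl // (@act_widen n Q) ?leq_maxr //.
rewrite (@act_widen n) ?size_polyD // -big_split; apply: eq_bigr => i _ /=.
by rewrite coefD rmorphD mulrDl.
Qed.

Lemma actN P x : act (- P) x = - act P x.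
Proof. by apply/eqP; rewrite -addr_eq0 -actD addNr act0. Qed.

Lemma actB P Q x : act (P - Q) x = act P x - act Q x.
Proof. by rewrite actD actN. Qed.

Lemma act_mulX P x : act (P * 'X) x = act P (D x).
Proof.
have sz : (size (P * 'X)%R <= (size P).+1)%N.
  by rewrite (leq_trans (size_polyMleq _ _)) // size_polyX addn2.
rewrite (act_widen _ sz) big_ord_recl coefMX rmorph0 mul0r add0r.
by apply: eq_bigr => i _; rewrite coefMX /= -iterSr.
Qed.

Lemma act_Xn n x : act 'X^n x = iter n D x.
Proof.
elim: n x => [|n IHn] x; first by rewrite expr0 actC rmorph1 mul1r.
by rewrite exprSr act_mulX IHn -iterSr.
Qed.

Hypothesis D_add : {morph D : x y / x + y}.
Hypothesis D_scale : forall c x, D (ak c * x) = ak c * D x.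

Lemma D0 : D 0 = 0.
Proof. by apply: (addrI (D 0)); rewrite -D_add !addr0. Qed.

Lemma iterD_add i : {morph iter i D : x y / x + y}.
Proof. by elim: i => // i IHi x y /=; rewrite IHi D_add. Qed.

Lemma act_addr P : {morph act P : x y / x + y}.
Proof.
move=> x y; rewrite /act -big_split; apply: eq_bigr => i _ /=.
by rewrite iterD_add mulrDr.
Qed.

Lemma act_x0 P : act P 0 = 0.
Proof. by apply: (addrI (act P 0)); rewrite -act_addr !addr0. Qed.

Lemma act_oppr P x : act P (- x) = - act P x.
Proof. by apply/eqP; rewrite -addr_eq0 -act_addr addNr act_x0. Qed.

Lemma act_subr P x y : act P (x - y) = act P x - act P y.
Proof. by rewrite act_addr act_oppr. Qed.

Lemma act_sumr P I (r : seq I) (B : pred I) (F : I -> V) :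
  act P (\sum_(i <- r | B i) F i) = \sum_(i <- r | B i) act P (F i).
Proof. exact: (big_morph _ (act_addr P) (act_x0 P)). Qed.

End PolyAction.

Section PolyActionComm.

Variables (k : comNzRingType) (V : comNzRingType) (ak : {rmorphism k -> V}) (D : V -> V).
Implicit Types (P Q : {poly k}) (x y : V).
Hypothesis D_add : {morph D : x y / x + y}.
Hypothesis D_scale : forall c x, D (ak c * x) = ak c * D x.

Lemma D_act P x : D (act ak D P x) = act ak D P (D x).
Proof.
rewrite /act (big_morph _ D_add (D0 D_add)).
by apply: eq_bigr => i _; rewrite D_scale -iterS iterSr.
Qed.

Lemma actM P Q x : act ak D (P * Q) x = act ak D P (act ak D Q x).
Proof.
elim/poly_ind: P Q => [|P c IHP] Q; first by rewrite mul0r !act0.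
rewrite mulrDl -mulrA (mulrC 'X) !actD IHP !act_mulX D_act actC; congr (_ + _).
rewrite (@act_widen _ _ _ _ (size Q)).
  by rewrite mulr_sumr; apply: eq_bigr => i _; rewrite coefCM rmorphM mulrA.
by rewrite mul_polyC size_scale_leq.
Qed.

Lemma act_comm P Q x : act ak D P (act ak D Q x) = act ak D Q (act ak D P x).
Proof. by rewrite -!actM mulrC. Qed.

(** Restriction of scalars along X |-> X^r, the passage from F_q[s] to F_q[t]. *)
Lemma act_iter r P x : act ak (iter r D) P x = act ak D (P \Po 'X^r) x.
Proof.
elim/poly_ind: P x => [|P c IHP] x; first by rewrite comp_poly0 !act0.
rewrite comp_polyD comp_polyM comp_polyX comp_polyC !actD act_mulX !actC IHP.
by rewrite actM act_Xn.
Qed.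

(** Semilinear transport, for Galois automorphisms ([g] the identity) and for x |-> x^r ([g] a
    Frobenius power). *)
Lemma act_morph (f : {rmorphism V -> V}) (g : {rmorphism k -> k}) D' P x :
    (forall y, f (D y) = D' (f y)) -> (forall c, f (ak c) = ak (g c)) ->
  f (act ak D P x) = act ak D' (map_poly g P) (f x).
Proof.
move=> fD fak; rewrite [RHS](@act_widen _ _ _ _ (size P)) ?size_poly // rmorph_sum.
apply: eq_bigr => i _; rewrite rmorphM fak coef_map; congr (_ * _).
by elim: (nat_of_ord i) => //= j <-.
Qed.

End PolyActionComm.

(** * Expansion of the powers of s + tau *)

Section TwistedExpansion.

Variables (q : nat) (R : comNzRingType).
Implicit Types (s x : R).

(* The coefficient of tau^i in (s + tau)^n. *)
Fixpoint tau_coef s n i : R := match n, i with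
  | 0, 0 => 1
  | 0, _.+1 => 0
  | n'.+1, 0 => s * tau_coef s n' 0
  | n'.+1, i'.+1 => s * tau_coef s n' i'.+1 + tau_coef s n' i' ^+ q
  end.

Hypothesis q_gt0 : (0 < q)%N.

Lemma tau_coef_gt s n i : (n < i)%N -> tau_coef s n i = 0.
Proof.
elim: n i => [|n IHn] [|i] //= lt_ni; rewrite !IHn ?mulr0 ?add0r ?expr0n ?gtn_eqF //.
exact: ltnW.
Qed.

Lemma tau_coef_diag s n : tau_coef s n n = 1.
Proof. by elim: n => //= n IHn; rewrite tau_coef_gt // mulr0 add0r IHn expr1n. Qed.

Lemma tau_coef0 s n : tau_coef s n 0 = s ^+ n.
Proof. by elim: n => //= n ->; rewrite exprS. Qed.

Hypothesis q_add : forall x y, (x + y) ^+ q = x ^+ q + y ^+ q.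

Lemma iter_tau s n x :
  iter n (fun x => s * x + x ^+ q) x = \sum_(i < n.+1) tau_coef s n i * x ^+ (q ^ i).
Proof.
have q0 : 0 ^+ q = 0 :> R by rewrite expr0n gtn_eqF.
elim: n => [|n IHn]; first by rewrite big_ord1 mul1r expr1.
rewrite iterS IHn (big_morph (fun x => x ^+ q) q_add q0) mulr_sumr.
(* The added top term is zero; it aligns this sum with the one shifted by tau. *)
have ->: \sum_(i < n.+1) s * (tau_coef s n i * x ^+ (q ^ i)) =
         \sum_(i < n.+2) s * (tau_coef s n i * x ^+ (q ^ i)).
  by rewrite [RHS]big_ord_recr /= tau_coef_gt // mul0r mulr0 addr0.
rewrite big_ord_recl [RHS]big_ord_recl /= mulrA -addrA -big_split; congr (_ + _).
by apply: eq_bigr => i _ /=; rewrite exprMn -exprM -expnSr mulrDl mulrA.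
Qed.

End TwistedExpansion.

Lemma rmorph_tau_coef q (R S : comNzRingType) (f : {rmorphism R -> S}) s n i :
  f (tau_coef q s n i) = tau_coef q (f s) n i.
Proof.
elim: n i => [|n IHn] [|i] /=; rewrite ?(rmorph0, rmorph1, rmorphM) ?IHn //.
by rewrite rmorphD rmorphM rmorphXn !IHn.
Qed.

(** * The Carlitz module of F_q[s] over an algebraically closed field *)

Section TorsionChain.

Variables (k : finFieldType) (Omega : closedFieldType) (ak : {rmorphism k -> Omega}).
Variable (S : Omega).
Local Notation q := #|k|.
Local Notation D := (fun x : Omega => S * x + x ^+ q).
Local Notation act := (act ak D).
Local Notation evalS := (fun P : {poly k} => (map_poly ak P).[S]).
Implicit Types (P Q : {poly k}) (x y z : Omega).

Let q_gt1 : (1 < q)%N. Proof. exact: finNzRing_gt1. Qed.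
Let q_gt0 : (0 < q)%N. Proof. exact: ltnW. Qed.

Lemma expr_card_add x y : (x + y) ^+ q = x ^+ q + y ^+ q.
Proof.
have [p p_pr pchark] := finPcharP k; rewrite (card_pprimeChar pchark).
have pcharO : p \in [pchar Omega] := rmorph_pchar ak pchark.
exact: (rmorphD (iter_frob pcharO _)).
Qed.

Lemma tau_add : {morph D : x y / x + y}.
Proof. by move=> x y; rewrite expr_card_add mulrDr addrACA. Qed.

Lemma tau_scale c x : D (ak c * x) = ak c * D x.
Proof. by rewrite /= exprMn -rmorphXn expf_card mulrDr mulrCA. Qed.

(** Expand P(S + tau) in powers of tau: the constant term collects the P_i S^i, and the top term
    comes only from the leading term of P. *)
Lemma act_tauE P : exists b : nat -> Omega,
  [/\ forall x, act P x = \sum_(j < size P) b j * x ^+ (q ^ j),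
      b 0 = evalS P & b (size P).-1 = ak (lead_coef P)].
Proof.
exists (fun j => \sum_(i < size P) ak P`_i * tau_coef q S i j); split=> [x||].
- rewrite actE; under [RHS]eq_bigr => j _ do rewrite mulr_suml.
  rewrite [RHS]exchange_big; apply: eq_bigr => i _ /=.
  rewrite (iter_tau q_gt0 expr_card_add) mulr_sumr.
  rewrite (big_ord_widen (size P) (fun j => ak P`_i * (tau_coef q S i j * x ^+ (q ^ j)))) //.
  rewrite big_mkcond; apply: eq_bigr => j _; rewrite mulrA.
  by case: ltnP => // lt_ij; rewrite tau_coef_gt // mulr0 mul0r.
- rewrite horner_coef size_map_poly; apply: eq_bigr => i _.
  by rewrite tau_coef0 coef_map.
rewrite lead_coefE; have [-> | nz_P] := eqVneq P 0.
  by rewrite size_poly0 big_ord0 coef0 rmorph0.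
have: size P = (size P).-1.+1 by rewrite prednK ?size_poly_gt0.
move: (size P).-1 => n ->.
rewrite big_ord_recr /= (tau_coef_diag q_gt0) mulr1 big1 ?add0r // => i _.
by rewrite tau_coef_gt ?mulr0.
Qed.

Definition qpolynomial (b : nat -> Omega) n : {poly Omega} :=
  \sum_(j < n) b j *: 'X^(q ^ j).

Lemma coef_qpolynomial b n j : (qpolynomial b n)`_(q ^ j) = if (j < n)%N then b j else 0.
Proof.
rewrite coef_sum; under eq_bigr => i _ do rewrite coefZ coefXn eqn_exp2l //.
have [lt_jn | le_nj] := ltnP j n.
  rewrite (bigD1 (Ordinal lt_jn)) //= eqxx mulr1 big1 ?addr0 // => i.
  by rewrite eq_sym -val_eqE /= => /negPf->; rewrite mulr0.
by rewrite big1 // => i _; rewrite gtn_eqF ?mulr0 // (leq_trans (ltn_ord i)).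
Qed.

Lemma horner_qpolynomial b n x :
  (qpolynomial b n).[x] = \sum_(j < n) b j * x ^+ (q ^ j).
Proof. by rewrite horner_sum; apply: eq_bigr => j _; rewrite !hornerE. Qed.

Lemma size_qpolynomial b n : (size (qpolynomial b n) <= (q ^ n.-1).+1)%N.
Proof.
apply: (leq_trans (size_sum _ _ _)); apply/bigmax_leqP => j _.
rewrite (leq_trans (size_scale_leq _ _)) // size_polyXn ltnS leq_exp2l //.
by case: n j => [[]|n [j]].
Qed.

(** P(S) is the coefficient of X^(q^0) = X, so the polynomial to solve is not constant. The boolean
    equality serves [xchoose]. *)
Lemma act_surj P y : evalS P != 0 -> exists x, act P x == y.
Proof.
move=> nz_P; have P_gt0 : (0 < size P)%N.
  by rewrite size_poly_gt0; apply: contraNneq nz_P => ->; rewrite rmorph0 horner0.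
have [b [bE b0 _]] := act_tauE P; rewrite -b0 in nz_P.
have /closed_rootP[x]: size (qpolynomial b (size P) - y%:P) != 1%N.
  apply: contraNneq nz_P => sz1.
  have := coef_qpolynomial b (size P) 0; rewrite P_gt0 => <-.
  have : (qpolynomial b (size P) - y%:P)`_1 = 0 by rewrite nth_default ?sz1.
  by rewrite coefB coefC subr0 => ->.
by rewrite rootE !hornerE horner_qpolynomial subr_eq0 -bE; exists x.
Qed.

(** Dividing the q-polynomial by X leaves exponents q^j - 1 and the constant term P(S), so the roots
    are nonzero. *)
Lemma act_ker_neq0 P : evalS P != 0 -> (1 < size P)%N ->
  exists2 x, x != 0 & act P x = 0.
Proof.
move=> nz_P P_gt1; have [b [bE b0 bd]] := act_tauE P; rewrite -b0 in nz_P.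
pose g : {poly Omega} := \sum_(j < size P) b j *: 'X^((q ^ j).-1).
have gE j : (j < size P)%N -> g`_(q ^ j).-1 = b j.
  move=> lt_j; rewrite coef_sum (bigD1 (Ordinal lt_j)) //= coefZ coefXn eqxx mulr1.
  rewrite big1 ?addr0 // => i; rewrite -val_eqE /= coefZ coefXn eq_sym => /negPf ne_ij.
  by rewrite -eqSS !prednK ?expn_gt0 ?q_gt0 // eqn_exp2l // ne_ij mulr0.
have /closed_rootP[x]: size g != 1%N.
  have nz_d : b (size P).-1 != 0.
    by rewrite bd fmorph_eq0 lead_coef_eq0 -size_poly_gt0 ltnW.
  apply: contraNneq nz_d => sz1; rewrite -gE ?prednK ?(ltnW P_gt1) //.
  rewrite nth_default // sz1 -ltnS prednK ?expn_gt0 ?q_gt0 //.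
  by rewrite -{1}(expn0 q) ltn_exp2l // -ltnS prednK // ltnW.
rewrite rootE => /eqP gx0; exists x.
  apply: contraNneq nz_P => x0; move: gx0.
  by rewrite x0 horner_coef0 -gE ?expn0 ?(ltnW P_gt1) // => ->.
rewrite bE; transitivity (g.[x] * x); last by rewrite gx0 mul0r.
rewrite horner_sum mulr_suml; apply: eq_bigr => j _.
by rewrite !hornerE -mulrA -exprSr prednK // expn_gt0 q_gt0.
Qed.

(** * A chain of h-division points and the h-power torsion *)

Variables (h : {poly k}) (lam : nat -> Omega).
Hypotheses (h_irr : irreducible_poly h) (h_S : evalS h != 0).
Hypotheses (lam0_neq0 : lam 0 != 0) (h_lam0 : act h (lam 0) = 0).
Hypothesis h_lamS : forall j, act h (lam j.+1) = lam j.

Lemma act_dvd P Q x : P %| Q -> act P x = 0 -> act Q x = 0.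
Proof. by case/dvdpP=> T -> Px; rewrite (actM tau_add tau_scale) Px (act_x0 _ tau_add). Qed.

(** Otherwise a Bezout relation makes a nonzero constant kill [lam 0]. *)
Lemma act_lam0_eq0 P : act P (lam 0) = 0 -> h %| P.
Proof.
move=> P0; apply: contraT; rewrite -irreducible_poly_coprime //.
case/Bezout_coprimepP=> [[U T]] /= /eqpP[[c d] /= /andP[nz_c nz_d] Dcd].
case/eqP: lam0_neq0; apply: (mulfI (_ : ak d != 0)); first by rewrite fmorph_eq0.
rewrite mulr0 -(actC _ D) -[d%:P]mulr1 mul_polyC -Dcd -mul_polyC.
rewrite (actM tau_add tau_scale) actD !(actM tau_add tau_scale) P0 h_lam0.
by rewrite !(act_x0 _ tau_add) addr0 (act_x0 _ tau_add).
Qed.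

(** Counting: polynomials of degree below d = deg h give q^d distinct torsion points, and these are
    roots of a nonzero polynomial of degree at most q^d. *)
Lemma act_lam0_span x : act h x = 0 -> exists P, x = act P (lam 0).
Proof.
move=> hx; set d := (size h).-1.
have h_gt0 : (0 < size h)%N by rewrite (ltn_trans _ h_irr.1).
pose F (v : 'rV[k]_d) := act (rVpoly v) (lam 0).
have F_inj : injective F.
  move=> v w /eqP; rewrite -subr_eq0 -actB => /eqP/act_lam0_eq0; rewrite -raddfB /=.
  move/(dvdp_leq _) => le_h; apply/eqP; rewrite -subr_eq0.
  rewrite -(inj_eq (can_inj rVpolyK)) raddf0; apply: contraT => /le_h.
  by rewrite leqNgt (leq_ltn_trans (size_poly _ _)) // /d prednK.
have [b [bE b0 _]] := act_tauE h.
have : x \in codom F.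
  apply: contraT => F'x.
  have: (size (x :: codom F) < size (qpolynomial b (size h)))%N.
    apply: max_poly_roots.
    - apply: contraNneq h_S => f0; rewrite -b0.
      by have := coef_qpolynomial b (size h) 0; rewrite h_gt0 f0 coef0 => <-.
    - apply/allP => y; rewrite inE rootE horner_qpolynomial -bE.
      case/predU1P => [->|/codomP[v ->]]; first by rewrite hx.
      by rewrite /F (act_comm tau_add tau_scale) h_lam0 (act_x0 _ tau_add).
    by rewrite /= F'x /codom (map_inj_uniq F_inj) enum_uniq.
  rewrite /= size_codom card_mx mul1n => /leq_trans/(_ (size_qpolynomial _ _)).
  by rewrite ltnn.
by case/codomP => v ->; exists (rVpoly v).
Qed.

Lemma act_hX_lam j n : act (h ^+ j) (lam (j + n)) = lam n.
Proof.
elim: j => [|j IHj]; first by rewrite expr0 actC rmorph1 mul1r.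
by rewrite exprSr (actM tau_add tau_scale) addSn h_lamS.
Qed.

Lemma act_hX_lam0 j n : (n < j)%N -> act (h ^+ j) (lam n) = 0.
Proof.
move=> lt_nj; rewrite -(subnK lt_nj) exprD exprS !(actM tau_add tau_scale).
by have := act_hX_lam n 0; rewrite addn0 => ->; rewrite h_lam0 (act_x0 _ tau_add).
Qed.

Variables (r : nat).
(* Every residue class mod h is an r-th power, which lets F_q[X^r] span as much as F_q[X]. *)
Hypothesis residue_root : forall P, exists T, h %| P - (T \Po 'X^r).

(** In the induction, h^n sends x to the h-torsion, to some P [lam 0]. With T(X^r) congruent to P
    mod h, subtracting T(X^r) [lam n] leaves an h^n-torsion point. *)
Lemma act_span n x : act (h ^+ n) x = 0 ->
  exists b : nat -> {poly k}, x = \sum_(l < n) act (b l \Po 'X^r) (lam l).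
Proof.
elim: n x => [|n IHn] x.
  by rewrite expr0 actC rmorph1 mul1r => ->; exists (fun=> 0); rewrite big_ord0.
rewrite exprS (actM tau_add tau_scale) => /act_lam0_span[P DP].
have [T hT] := residue_root P.
have [|b Db] := IHn (x - act (T \Po 'X^r) (lam n)).
  rewrite (act_subr _ tau_add) (act_comm tau_add tau_scale) DP.
  have := act_hX_lam n 0; rewrite addn0 => ->; rewrite -actB.
  exact: act_dvd hT h_lam0.
exists (fun l => if l == n then T else b l); rewrite big_ord_recr /= eqxx.
apply: (canRL (subrK _)); rewrite Db; apply: eq_bigr => l _.
by rewrite (ltn_eqF (ltn_ord l)).
Qed.

(** Applying h^n to a relation with last index n leaves a_n(X^r) [lam 0], so g divides a_n. Then h^r
    divides a_n(X^r), which kills [lam n] as n < r, and the relation shortens. *)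
Lemma act_free (g : {poly k}) n (a : nat -> {poly k}) :
    g \Po 'X^r = h ^+ r -> (forall P, h %| P \Po 'X^r -> g %| P) -> (n <= r)%N ->
  \sum_(l < n) act (a l \Po 'X^r) (lam l) = 0 -> forall l, (l < n)%N -> g %| a l.
Proof.
move=> gE g_dvd; elim: n => [|n IHn] lt_nr // sum0 l; rewrite ltnS leq_eqVlt.
have g_an : g %| a n.
  have: act (h ^+ n) (\sum_(l < n.+1) act (a l \Po 'X^r) (lam l)) = 0.
    by rewrite sum0 (act_x0 _ tau_add).
  rewrite (act_sumr _ tau_add) big_ord_recr /= big1 ?add0r => [|i _]; last first.
    by rewrite (act_comm tau_add tau_scale) act_hX_lam0 // (act_x0 _ tau_add).
  rewrite (act_comm tau_add tau_scale); have := act_hX_lam n 0; rewrite addn0 => ->.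
  by move/act_lam0_eq0/g_dvd.
case/predU1P => [-> // | lt_ln]; apply: IHn lt_ln; first exact: ltnW.
move: sum0; rewrite big_ord_recr /= [X in _ + X](act_dvd (P := h ^+ r)) ?addr0 //.
  by rewrite -gE; case/dvdpP: g_an => T ->; rewrite rmorphM dvdp_mull.
exact: act_hX_lam0.
Qed.

End TorsionChain.

(** * Frobenius and divisibility in k[X] *)

Lemma dvdp_expr_card_sub (k : finFieldType) (h P : {poly k}) M :
    h \is monic -> irreducible_poly h ->
  h %| P ^+ ((#|k| ^ (size h).-1) ^ M) - P.
Proof.
move=> h_mon h_irr; have hI : monic_irreducible_poly h by [].
have in0 Q : (in_qpoly h Q == 0) = (h %| Q).
  apply/eqP/idP => [/val_eqP /= | hQ].
    by rewrite -Pdiv.IdomainMonic.modpE ?(mk_monicE hI).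
  by apply/val_eqP; rewrite /= -Pdiv.IdomainMonic.modpE ?(mk_monicE hI).
rewrite -in0 rmorphB rmorphXn subr_eq0; apply/eqP.
(* Fermat in the finite field k[X]/(h). *)
rewrite -(card_qfpoly hI); elim: M => [|M IHM]; first by rewrite expr1.
by rewrite expnSr exprM IHM; apply: (@expf_card {poly %/ h with hI}).
Qed.

Lemma expf_card_exp (k : finFieldType) n (x : k) : x ^+ (#|k| ^ n) = x.
Proof. by elim: n => [|n IHn]; rewrite ?expr1 // expnSr exprM IHn expf_card. Qed.

Lemma act_ext (k : nzRingType) (V : comNzRingType) (ak : {rmorphism k -> V}) D D' P x :
  D =1 D' -> act ak D P x = act ak D' P x.
Proof. by move=> DD'; apply: eq_bigr => i _; rewrite (eq_iter DD'). Qed.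

Lemma map_iter_frobK (k : finFieldType) p (pchark : p \in [pchar k]) m j n :
    (p ^ (m + j) = #|k| ^ n)%N ->
  cancel (map_poly (iter_frob pchark m)) (map_poly (iter_frob pchark j)).
Proof.
move=> mjE P; apply/polyP => i; rewrite !coef_map /= /iter_frob.
by rewrite -exprM -expnD mjE expf_card_exp.
Qed.

Lemma irreducible_map_poly (k : fieldType) (f g : {rmorphism k -> k}) (P : {poly k}) :
  cancel (map_poly f) (map_poly g) -> irreducible_poly (map_poly f P) -> irreducible_poly P.
Proof.
move=> fK [sz_P irrP]; split=> [|Q szQ QP]; first by rewrite size_map_poly in sz_P.
by rewrite -(eqp_map f) irrP ?size_map_poly ?dvdp_map.
Qed.

Lemma irreducible_dvdp_exp (k : fieldType) (h P : {poly k}) n :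
  irreducible_poly h -> h %| P ^+ n -> h %| P.
Proof.
move=> h_irr hPn; apply: contraT; rewrite -irreducible_poly_coprime // => co_hP.
have := coprimep_expr n co_hP; rewrite irreducible_poly_coprime //.
by rewrite hPn.
Qed.

(** * The restricted Carlitz module satisfies D1 and D2 *)

Section RestrictedCarlitz.

Variables (k : finFieldType) (K : fieldExtType {fraction {poly k}}).
Variables (p m : nat) (s : K).
Hypothesis pchark : p \in [pchar k].
Local Notation q := #|k|.
Local Notation r := (p ^ m)%N.
Hypothesis s_t : s ^+ r = embA K 'X.

Let p_pr : prime p. Proof. exact: pcharf_prime pchark. Qed.
Let r_gt0 : (0 < r)%N. Proof. by rewrite expn_gt0 prime_gt0. Qed.
Let q_gt0 : (0 < q)%N. Proof. exact: ltnW (finNzRing_gt1 k). Qed.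

(** Coefficients of (s + tau)^r from tau^1 on; [drin_t] supplies the constant term s^r = t. *)
Definition carlitz_coefs : seq K := mkseq (fun i => tau_coef q s r i.+1) r.

Lemma last_carlitz_coefs : last 1 carlitz_coefs = 1.
Proof.
rewrite (last_nth 0) size_mkseq -(prednK r_gt0) /= nth_mkseq prednK //.
exact: tau_coef_diag.
Qed.

Lemma carlitz_coefs_D1 pi : D1 pi carlitz_coefs.
Proof.
move=> O [O1 O_BM O_val [_ _] OA] _.
have [OB OM] : (forall x y, x \in O -> y \in O -> x - y \in O) /\
               (forall x y, x \in O -> y \in O -> x * y \in O).
  by split=> x y Ox Oy; case: (O_BM x y Ox Oy).
have O0 : 0 \in O by rewrite -(subrr 1) OB.
have OD x y : x \in O -> y \in O -> x + y \in O.
  by move=> Ox Oy; rewrite -[y]opprK OB // -sub0r OB.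
have OX x n : x \in O -> x ^+ n \in O.
  by move=> Ox; elim: n => // n IHn; rewrite exprS OM.
have Os : s \in O.
  have [-> // | nz_s] := eqVneq s 0; have [// | Os1] := O_val s nz_s.
  (* Integral closedness: if s^-1 is in O, then s = s^r (s^-1)^(r-1) is too. *)
  have ->: s = embA K 'X * s^-1 ^+ r.-1; last by rewrite OM ?OX.
  by rewrite -s_t -{1}(prednK r_gt0) exprS exprVn mulfK // expf_neq0.
have Oc n i : tau_coef q s n i \in O.
  elim: n i => [|n IHn] [|i] //=; first exact: OM Os (IHn _).
  exact: OD (OM _ _ Os (IHn _)) (OX _ _ (IHn _)).
exists 1; split; first exact: oner_neq0.
split=> [i|]; last first.
  by rewrite last_carlitz_coefs !(mul1r, expr1n, invr1); split; rewrite ?invr1 ?oner_neq0.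
have := ltn_ord i; rewrite {2}size_mkseq => lt_ir.
by rewrite mul1r expr1n invr1 mulr1 nth_mkseq //; apply: Oc.
Qed.

Section Torsion.

Variables (Omega : closedFieldType) (iota : {rmorphism K -> Omega}).
Local Notation emb := (fun a : {poly k} => iota (embA K a)).
Local Notation S := (iota s).
Local Notation D := (fun x : Omega => S * x + x ^+ q).
Local Notation ak := (iota \o (embA K \o polyC)).

Lemma iota_embA a : (map_poly ak a).[S ^+ r] = emb a.
Proof. by rewrite -rmorphXn s_t [in RHS]embA_horner -horner_map -map_poly_comp. Qed.

Lemma drin_carlitz_coefs a x :
  drin_act emb (map iota carlitz_coefs) a x = act ak D (a \Po 'X^r) x.
Proof.
have DD := @tau_add k Omega ak S; have DZ := @tau_scale k Omega ak S.
rewrite -(act_iter DD DZ) -[LHS]/(act ak (drin_t k (emb 'X) (map iota carlitz_coefs)) a x).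
apply: act_ext => y; rewrite /drin_t (iter_tau q_gt0 (expr_card_add ak)).
rewrite big_ord_recl tau_coef0 expr1 -rmorphXn s_t size_map size_mkseq; congr (_ + _).
apply: eq_bigr => i _; rewrite (nth_map 0) ?size_mkseq // nth_mkseq //.
by rewrite rmorph_tau_coef.
Qed.

(* x |-> x^r carries the Carlitz module of F_q[s] to that of F_q[t]. *)
Lemma carlitz_act_exp a x :
  carlitz_act emb (map_poly (iter_frob pchark m) a) (x ^+ r) = act ak D a x ^+ r.
Proof.
have pcharO : p \in [pchar Omega] := rmorph_pchar ak pchark.
have fD y : iter_frob pcharO m (S * y + y ^+ q) =
            drin_t k (emb 'X) [:: 1] (iter_frob pcharO m y).
  rewrite /drin_t big_ord1 mul1r expn1 rmorphD rmorphM /= -s_t rmorphXn.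
  by rewrite /iter_frob -!exprM mulnC.
have fk c : iter_frob pcharO m (ak c) = ak (iter_frob pchark m c).
  by rewrite /iter_frob -!rmorphXn.
exact: esym (act_morph a x fD fk).
Qed.

End Torsion.

Variables (pi : {poly k}) (j n : nat).
Hypotheses (pi_monic : pi \is monic) (pi_irr : irreducible_poly pi).
Hypothesis jE : (p ^ (m + j) = q_pi pi ^ n)%N.
Hypothesis j_le : (p ^ j <= (q_pi pi).-1)%N.

Lemma carlitz_coefs_D2 : D2 r pi carlitz_coefs.
Proof.
move=> Omega iota emb phi C.
pose S := iota s; pose ak : {rmorphism k -> Omega} := iota \o (embA K \o polyC).
pose D := (fun x : Omega => S * x + x ^+ q).
have DD : {morph D : x y / x + y} := @tau_add k Omega ak S.
have DZ c x : D (ak c * x) = ak c * D x := @tau_scale k Omega ak S c x.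
pose fm := iter_frob pchark m; pose fj := iter_frob pchark j.
have mjE : (p ^ (m + j) = q ^ ((size pi).-1 * n))%N by rewrite jE -expnM.
have fmK : cancel (map_poly fm) (map_poly fj) := map_iter_frobK pchark mjE.
have fjK : cancel (map_poly fj) (map_poly fm).
  by apply: (map_iter_frobK pchark (n := (size pi).-1 * n)); rewrite addnC.
(* [fj] inverts [fm] on coefficients, so those of h are the r-th roots of those of pi. *)
pose h := map_poly fj pi.
have h_mon : h \is monic by rewrite map_monic.
have h_irr : irreducible_poly h by apply: (irreducible_map_poly fmK); rewrite fjK.
have pi_h : pi \Po 'X^r = h ^+ r by rewrite -[pi]fjK map_iter_frob.
(* Its r-th power is the image of pi, which is nonzero. *)
have h_S : (map_poly ak h).[S] != 0.
  have : emb pi != 0 by rewrite fmorph_eq0 scaler_eq0 oner_eq0 orbF tofrac_eq0 monic_neq0.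
  rewrite /emb -iota_embA -/ak; apply: contraNneq => h0.
  rewrite -hornerXn -horner_comp -(map_polyXn ak) -map_comp_poly pi_h rmorphXn.
  by rewrite horner_exp h0 expr0n gtn_eqF.
have [lam0 nz_lam0 h_lam0] : exists2 x, x != 0 & act ak D h x = 0.
  by apply: act_ker_neq0; rewrite // h_irr.1.
have surj y := act_surj y h_S.
pose lam i := iter i (fun y => xchoose (surj y)) lam0.
have h_lamS i : act ak D h (lam i.+1) = lam i by apply/eqP/(xchooseP (surj (lam i))).
have res_root P : exists T, h %| P - (T \Po 'X^r).
  (* Substituting X^r in this witness gives P^(q_pi^n), congruent to P mod h. *)
  exists (map_poly fm (P ^+ (p ^ j))); rewrite map_iter_frob -exprM -expnD addnC jE.
  rewrite -dvdpNr opprB /q_pi -(size_map_poly fj pi); exact: dvdp_expr_card_sub.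
have phiE a x : phi a x = act ak D (a \Po 'X^r) x by apply: drin_carlitz_coefs.
have h_dvd P : h %| P \Po 'X^r -> pi %| P.
  rewrite -{1}[P]fjK map_iter_frob => /(irreducible_dvdp_exp h_irr).
  by rewrite dvdp_map.
have span_lam := act_span h_irr h_S nz_lam0 h_lam0 h_lamS res_root.
exists (fun i => lam i), (fun=> (p ^ j)%N); split; last split; last split; last split => //.
- by move=> i; rewrite phiE pi_h; apply: (act_hX_lam0 h_lam0 h_lamS).
- move=> mu; rewrite phiE pi_h => /span_lam[b ->].
  by exists (fun i => b i); apply: eq_bigr => i _; rewrite phiE.
(* [a'] extends [a] by 0 to all naturals. *)
- move=> a sum0 i; pose a' l := if insub l is Some i then a i else 0.
  have <-: a' i = a i by rewrite /a' valK.
  apply: (act_free h_irr nz_lam0 h_lam0 h_lamS pi_h h_dvd (leqnn r)) => //.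
  by rewrite -[RHS]sum0; apply: eq_bigr => l _; rewrite phiE /a' valK.
move=> sigma _ sigmaK.
have sigmaE P x : sigma (act ak D P x) = act ak D P (sigma x).
  rewrite (act_morph (g := idfun) (D' := D)) ?map_poly_id // => [y|c].
    by rewrite /D rmorphD rmorphM rmorphXn sigmaK.
  by rewrite /ak /= sigmaK.
have [P0 DP0] : exists P, sigma lam0 = act ak D P lam0.
  apply: (act_lam0_span (lam := lam) h_irr h_S nz_lam0 h_lam0).
  by rewrite -sigmaE h_lam0 rmorph0.
(* x |-> x^r maps the h-torsion onto C[pi] and twists coefficients by [fm]. *)
exists (map_poly fm P0); split=> [mu | i].
  have [x ->] : exists x, mu = x ^+ r.
    have /closed_rootP[x]: size ('X^r - mu%:P) != 1%N.
      by rewrite size_XnsubC // eqSS -lt0n.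
    by rewrite rootE !hornerE subr_eq0 => /eqP <-; exists x.
  rewrite /C -{1}[pi]fjK !carlitz_act_exp => /eqP; rewrite expf_eq0 r_gt0 => /eqP hx.
  have [P ->] := act_lam0_span (lam := lam) h_irr h_S nz_lam0 h_lam0 hx.
  by rewrite rmorphXn sigmaE DP0 (act_comm DD DZ).
(* Substituting X^r turns c^(p^j) into P0^(q_pi^n), congruent to P0 mod h. So h^i kills the
   difference, and only [lam l] with l < i occur. *)
have [b Db] : exists b : nat -> {poly k},
    sigma (lam i) - phi (map_poly fm P0 ^+ (p ^ j)) (lam i)
      = \sum_(l < i) act ak D (b l \Po 'X^r) (lam l).
  apply: span_lam; rewrite phiE rmorphXn /= map_iter_frob -exprM -expnD jE.
  rewrite (act_subr _ DD) -sigmaE (act_comm DD DZ).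
  have := act_hX_lam h_lamS i 0; rewrite addn0 => ->.
  rewrite DP0 -actB -opprB; apply: (act_dvd _ h_lam0); rewrite dvdpNr.
  by rewrite /q_pi -(size_map_poly fj pi); apply: dvdp_expr_card_sub.
exists (fun l => b l); apply/eqP; rewrite addrC -subr_eq Db; apply/eqP.
rewrite (big_ord_widen r (fun l => act ak D (b l \Po 'X^r) (lam l)) (ltnW (ltn_ord i))).
by apply: eq_bigr => l _; rewrite phiE.
Qed.

End RestrictedCarlitz.

Theorem theorem5p6 (k : finFieldType) (K : fieldExtType {fraction {poly k}})
  (Ks : {subfield K}) (r : nat) (pi : {poly k}) :
  is_separable_closure Ks -> (0 < r)%N -> (r %| \dim_Ks {:K})%N ->
  pi \is monic -> irreducible_poly pi ->
  exists cs : seq K, in_D r pi cs.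
Proof.
move=> Ks_sep r_gt0 dvd_r pi_monic pi_irr.
have [p p_pr pchark] := finPcharP k.
have [m [s [Dr s_t]]] := t_root_insep_degree pchark Ks_sep dvd_r.
have [N Dk] : exists N, #|k| = (p ^ N)%N by rewrite (card_pprimeChar pchark); eexists.
rewrite {}Dr in r_gt0 s_t *.
exists (carlitz_coefs p m s); split.
- by rewrite /drinfeld_module size_mkseq last_carlitz_coefs ?oner_neq0.
- exact: carlitz_coefs_D1.
pose d := (N * (size pi).-1)%N.
have qE : q_pi pi = (p ^ d)%N by rewrite /q_pi /qk Dk expnM.
have d_gt0 : (0 < d)%N.
  rewrite muln_gt0 -(subn1 (size pi)) subn_gt0 pi_irr.1 andbT lt0n.
  by apply: contraTneq (finNzRing_gt1 k) => N0; rewrite Dk N0.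
(* The residue of -m mod d: p^(m + j) is then a power of q_pi = p^d, and j < d keeps p^j below
   q_pi. *)
pose j := ((d.-1 * m) %% d)%N.
have /dvdnP[n jE] : (d %| m + j)%N.
  by rewrite /dvdn modnDmr -mulSn prednK // modnMr.
have mjE : (p ^ (m + j) = q_pi pi ^ n)%N by rewrite qE -expnM jE mulnC.
have j_le : (p ^ j <= (q_pi pi).-1)%N.
  by rewrite qE -ltnS prednK ?expn_gt0 ?prime_gt0 // ltn_exp2l ?prime_gt1 // ltn_pmod.
exact: (@carlitz_coefs_D2 _ _ _ _ _ pchark s_t _ _ _ pi_monic pi_irr mjE j_le).
Qed.
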